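(* Let $\mathfrak{C}=(V,K)\models T^*_\infty$. The conclusion that every group $G$ definable in $T^*_\infty$ is ([semi]algebraic-by-abelian)-by-[semi]algebraic cannot be strengthened to ''$G$ is [semi]algebraic-by-abelian'', nor to ''$G$ is abelian-by-[semi]algebraic'' (algebraic for $T_\infty$, semialgebraic for $T^{RCF}_\infty$). More precisely: (i) The definable group $V\rtimes K^*$, where $K^*$ acts on $(V,+)$ by scalar multiplication, is not [semi]algebraic-by-abelian. (ii) The Heisenberg group of $[\cdot,\cdot]$, i.e. the definable group $V\times V\times K$ with multiplication $(v,w,a)\cdot(v',w',a')=(v+v',\,w+w',\,a+a'+[v,w'])$, is not abelian-by-[semi]algebraic.
   Context: Theories: fix $p$ equal to $0$ or a prime different from $2$. $L$ is the two-sorted language with a sort $V$ (vectors) and a sort $K$ (scalars), with symbols for $0_V,0_K,1_K$, vector addition, field addition and multiplication, scalar multiplication, and a map $[\cdot,\cdot]:V\times V\to K$. $T_\infty$ denotes either of the two $L$-theories saying that $K$ is an algebraically closed field of characteristic $p$, $V$ is an infinite-dimensional $K$-vector space and $[\cdot,\cdot]$ is a nondegenerate symmetric, respectively nondegenerate alternating, $K$-bilinear form. $T^{RCF}_\infty$ denotes either of the two theories saying that $K$ is a real closed field, $V$ is an infinite-dimensional $K$-vector space, and $[\cdot,\cdot]$ is symmetric positive-definite, respectively nondegenerate alternating. $T^*_\infty$ means any of these theories. $\mathfrak{C}$ is an $\aleph_0$-saturated model. ''Definable'' means with parameters. A group interpretable in $\mathfrak{C}$ is algebraic [semialgebraic]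 if it is definably isomorphic to an algebraic [semialgebraic] group over the field of scalars $K$. For properties $P,Q$ of groups, a definable group $G$ is $P$-by-$Q$ if there is a definable normal subgroup $N\trianglelefteq G$ such that $N$ has $P$ and $G/N$ has $Q$. ($([semi]$algebraic-by-abelian)-by-[semi]algebraic means there are definable $N\trianglelefteq G$, $N_0\trianglelefteq N$ with $N_0$, $G/N$ [semi]algebraic and $N/N_0$ abelian.) *)

(* Defs.v *)
From Stdlib Require List.
From HB Require Import structures.
From mathcomp Require Import all_boot all_order all_algebra.
From mathcomp Require Import mpoly.

Set Implicit Arguments.
Unset Strict Implicit.
Unset Printing Implicit Defensive.

Import Order.TTheory GRing.Theory Num.Theory.
Local Open Scope ring_scope.

(* The two-sorted language L.  Variables of each sort are de Bruijn indices *)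
(* into the corresponding component of the environment.                     *)

Inductive vterm : Type :=
| VVar of nat
| VZero
| VAdd of vterm & vterm
| VScale of kterm & vterm
with kterm : Type :=
| KVar of nat
| KZero
| KOne
| KAdd of kterm & kterm
| KMul of kterm & kterm
| KForm of vterm & vterm.

(* The remaining connectives and the universal quantifiers are recovered
   classically. *)
Inductive formula : Type :=
| FEqV of vterm & vterm
| FEqK of kterm & kterm
| FNot of formula
| FAnd of formula & formula
| FExV of formula
| FExK of formula.

Section Definability.
Variables (K : fieldType) (V : lmodType K) (form : V -> V -> K).

Definition env : Type := (seq V * seq K)%type.

(* An index beyond the end of the environment denotes 0, which is named by a
   constant of L, so this does not affect which sets are definable. *)
Fixpoint vval (e : env) (t : vterm) : V :=
  match t with
  | VVar i => nth 0 e.1 i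
  | VZero => 0
  | VAdd t1 t2 => vval e t1 + vval e t2
  | VScale c t1 => kval e c *: vval e t1
  end
with kval (e : env) (t : kterm) : K :=
  match t with
  | KVar i => nth 0 e.2 i
  | KZero => 0
  | KOne => 1
  | KAdd t1 t2 => kval e t1 + kval e t2
  | KMul t1 t2 => kval e t1 * kval e t2
  | KForm t1 t2 => form (vval e t1) (vval e t2)
  end.

Fixpoint holds (e : env) (f : formula) : Prop :=
  match f with
  | FEqV t1 t2 => vval e t1 = vval e t2
  | FEqK t1 t2 => kval e t1 = kval e t2
  | FNot f1 => ~ holds e f1
  | FAnd f1 f2 => holds e f1 /\ holds e f2
  | FExV f1 => exists v : V, holds (v :: e.1, e.2) f1
  | FExK f1 => exists a : K, holds (e.1, a :: e.2) f1
  end.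

(* Every set of formulas in one variable (of either sort), with parameters
   from a finite tuple c, that is finitely satisfiable is satisfiable. *)
Definition aleph0_saturated : Prop :=
  forall c : env,
    (forall S : formula -> Prop,
       (forall D : seq formula, List.Forall S D ->
          exists v : V, List.Forall (holds (v :: c.1, c.2)) D) ->
       exists v : V, forall f, S f -> holds (v :: c.1, c.2) f)
    /\
    (forall S : formula -> Prop,
       (forall D : seq formula, List.Forall S D ->
          exists a : K, List.Forall (holds (c.1, a :: c.2)) D) ->
       exists a : K, forall f, S f -> holds (c.1, a :: c.2) f).

Definition point (m n : nat) : Type := (m.-tuple V * n.-tuple K)%type.

Definition env_of m n (x : point m n) : env := (tval x.1, tval x.2).

Definition env_cat (e1 e2 : env) : env := (e1.1 ++ e2.1, e1.2 ++ e2.2).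

(* The environment c holds the parameters.  Subsets of V^m x K^n, then binary
   and ternary relations between such spaces. *)
Definition definable m n (A : point m n -> Prop) : Prop :=
  exists (f : formula) (c : env), forall x,
    A x <-> holds (env_cat (env_of x) c) f.

Definition definable2 m1 n1 m2 n2
    (A : point m1 n1 -> point m2 n2 -> Prop) : Prop :=
  exists (f : formula) (c : env), forall x y,
    A x y <-> holds (env_cat (env_of x) (env_cat (env_of y) c)) f.

Definition definable3 m1 n1 m2 n2 m3 n3
    (A : point m1 n1 -> point m2 n2 -> point m3 n3 -> Prop) : Prop :=
  exists (f : formula) (c : env), forall x y z,
    A x y z <->
    holds (env_cat (env_of x) (env_cat (env_of y) (env_cat (env_of z) c))) f.

End Definability.

(* The group whose underlying set is the quotient of the subset gcar of     *)
(* V^m x K^n by the relation geqv.  The operations are given on             *)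
(* representatives; their values outside gcar are irrelevant.               *)

Record igroup (K : fieldType) (V : lmodType K) : Type := IGroup {
  gm : nat;
  gn : nat;
  gcar : point V gm gn -> Prop;
  geqv : point V gm gn -> point V gm gn -> Prop;
  gop : point V gm gn -> point V gm gn -> point V gm gn;
  gone : point V gm gn;
  ginv : point V gm gn -> point V gm gn
}.

Arguments gcar {K V} _ _.
Arguments geqv {K V} _ _ _.
Arguments gop {K V} _ _ _.
Arguments ginv {K V} _ _.

Section Groups.
Variables (K : fieldType) (V : lmodType K) (form : V -> V -> K).
Implicit Type G : igroup V.

Definition geqv_equiv G : Prop :=
  [/\ forall x, gcar G x -> geqv G x x,
      forall x y, gcar G x -> gcar G y -> geqv G x y -> geqv G y x
    & forall x y z, gcar G x -> gcar G y -> gcar G z ->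
        geqv G x y -> geqv G y z -> geqv G x z].

Definition gop_closed G : Prop :=
  [/\ gcar G (gone G),
      forall x y, gcar G x -> gcar G y -> gcar G (gop G x y)
    & forall x, gcar G x -> gcar G (ginv G x)].

Definition gop_compat G : Prop :=
  forall x x' y y', gcar G x -> gcar G x' -> gcar G y -> gcar G y' ->
    geqv G x x' -> geqv G y y' -> geqv G (gop G x y) (gop G x' y').

Definition gop_group G : Prop :=
  [/\ forall x y z, gcar G x -> gcar G y -> gcar G z ->
        geqv G (gop G x (gop G y z)) (gop G (gop G x y) z),
      forall x, gcar G x -> geqv G (gop G (gone G) x) x
    & forall x, gcar G x -> geqv G (gop G (ginv G x) x) (gone G)].

Definition interpretable_group G : Prop :=
  [/\ [/\ definable form (gcar G),
          definable2 form (fun x y => [/\ gcar G x, gcar G y & geqv G x y])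
        & definable3 form
            (fun x y z => [/\ gcar G x, gcar G y, gcar G z
                            & geqv G (gop G x y) z])],
      geqv_equiv G, gop_closed G, gop_compat G & gop_group G].

Definition definable_group G : Prop :=
  interpretable_group G /\
  forall x y, gcar G x -> gcar G y -> (geqv G x y <-> x = y).

Definition abelian_igroup G : Prop :=
  forall x y, gcar G x -> gcar G y -> geqv G (gop G x y) (gop G y x).

Definition definable_normal_subgroup G
    (N : point V (gm G) (gn G) -> Prop) : Prop :=
  [/\ definable form N,
      forall x, N x -> gcar G x,
      forall x y, N x -> gcar G y -> geqv G x y -> N y,
      [/\ N (gone G), forall x y, N x -> N y -> N (gop G x y)
        & forall x, N x -> N (ginv G x)]
    & forall g x, gcar G g -> N x -> N (gop G (gop G (ginv G g) x) g)].

Definition subgroup_of G (N : point V (gm G) (gn G) -> Prop) : igroup V :=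
  @IGroup K V (gm G) (gn G) N (geqv G) (gop G) (gone G) (ginv G).

Definition quotient_of G (N : point V (gm G) (gn G) -> Prop) : igroup V :=
  @IGroup K V (gm G) (gn G) (gcar G) (fun x y => N (gop G (ginv G x) y))
    (gop G) (gone G) (ginv G).

Definition is_by (P Q : igroup V -> Prop) G : Prop :=
  exists N : point V (gm G) (gn G) -> Prop,
    [/\ definable_normal_subgroup N, P (subgroup_of N) & Q (quotient_of N)].

End Groups.

(* Abstract varieties in the style of Weil: sets of K-points with a finite  *)
(* atlas of affine charts.                                                  *)

Record atlas (K : fieldType) (X : Type) : Type := Atlas {
  aix : finType;
  adim : aix -> nat;
  adom : aix -> X -> Prop;
  achart : forall i : aix, X -> (adim i).-tuple K
}.

(* f induces an isomorphism from the interpretable group G onto H, and its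
   graph is definable in the charts of the atlas A. *)
Definition definable_iso (K : fieldType) (V : lmodType K) (form : V -> V -> K)
    (G : igroup V) (H : groupType) (A : atlas K H)
    (f : point V (gm G) (gn G) -> H) : Prop :=
  [/\ forall x y, gcar G x -> gcar G y -> f (gop G x y) = (f x * f y)%g,
      forall x y, gcar G x -> gcar G y -> (f x = f y <-> geqv G x y),
      forall h : H, exists2 x, gcar G x & f x = h
    & forall i : aix A,
        definable2 form (fun (x : point V (gm G) (gn G))
                             (t : point V 0 (adim i)) =>
          [/\ gcar G x, adom i (f x) & t.2 = achart i (f x)])].

Section Varieties.
Variable K : closedFieldType.

Definition zariski_closed n (A : n.-tuple K -> Prop) : Prop :=
  exists S : {mpoly K[n]} -> Prop,
    forall x, A x <-> forall q, S q -> q.@[tnth x] = 0.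

Definition zariski_open_in n (A U : n.-tuple K -> Prop) : Prop :=
  exists2 C, zariski_closed C & forall x, U x <-> A x /\ ~ C x.

Definition regular_on n (U : n.-tuple K -> Prop) (f : n.-tuple K -> K) : Prop :=
  forall x, U x ->
  exists W : n.-tuple K -> Prop,
    [/\ zariski_open_in U W, W x
      & exists g h : {mpoly K[n]}, forall y, W y ->
          h.@[tnth y] != 0 /\ f y = g.@[tnth y] / h.@[tnth y]].

Definition chart_image X (A : atlas K X) (i : aix A) (P : X -> Prop)
    (t : (adim i).-tuple K) : Prop :=
  exists x, [/\ adom i x, P x & t = achart i x].

Definition var_morphism X Y (A : atlas K X) (B : atlas K Y) (f : X -> Y) : Prop :=
  forall (i : aix A) (j : aix B),
    let U := chart_image (i := i) (fun x => adom j (f x)) in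
    zariski_open_in (chart_image (i := i) (fun=> True)) U /\
    exists F : (adim i).-tuple K -> (adim j).-tuple K,
      (forall x, adom i x -> adom j (f x) -> F (achart i x) = achart j (f x))
      /\ (forall l, regular_on U (fun t => tnth (F t) l)).

(* The fourth condition says that the overlaps are open and the transition
   maps regular; the last one is separatedness. *)
Definition is_variety X (A : atlas K X) : Prop :=
  [/\ forall x, exists i : aix A, adom i x,
      forall (i : aix A) x y, adom i x -> adom i y ->
        achart i x = achart i y -> x = y,
      forall i : aix A, zariski_closed (chart_image (i := i) (fun=> True)),
      var_morphism A A id
    & forall i j : aix A,
        zariski_closed (fun t : (adim i + adim j).-tuple K =>
          exists x, [/\ adom i x, adom j x
                      & t = [tuple of achart i x ++ achart j x]])].

Definition atlas_prod X Y (A : atlas K X) (B : atlas K Y) : atlas K (X * Y) :=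
  @Atlas K (X * Y) (aix A * aix B)%type
    (fun ij => (adim ij.1 + adim ij.2)%N)
    (fun ij xy => adom ij.1 xy.1 /\ adom ij.2 xy.2)
    (fun ij xy => [tuple of achart ij.1 xy.1 ++ achart ij.2 xy.2]).

Record algebraic_group : Type := AlgebraicGroup {
  ag_group : groupType;
  ag_atlas : atlas K ag_group;
  ag_variety : is_variety ag_atlas;
  ag_mul : var_morphism (atlas_prod ag_atlas ag_atlas) ag_atlas
             (fun xy => (xy.1 * xy.2)%g);
  ag_inv : var_morphism ag_atlas ag_atlas (fun x => x^-1%g)
}.

Definition algebraic (V : lmodType K) (form : V -> V -> K) (G : igroup V)
    : Prop :=
  exists (H : algebraic_group) (f : point V (gm G) (gn G) -> ag_group H),
    definable_iso form (ag_atlas H) f.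

End Varieties.

Section Semialgebraic.
Variable K : rcfType.

(* A finite union of sets given by finitely many equations and strict
   inequalities. *)
Definition semialgebraic_set n (A : n.-tuple K -> Prop) : Prop :=
  exists D : seq (seq {mpoly K[n]} * seq {mpoly K[n]}), forall x,
    A x <-> has (fun d => all (fun q => q.@[tnth x] == 0) d.1 &&
                          all (fun q => 0 < q.@[tnth x]) d.2) D.

(* sg_coord identifies the group with a semialgebraic subset of K^n. *)
Record semialgebraic_group : Type := SemialgebraicGroup {
  sg_group : groupType;
  sg_dim : nat;
  sg_coord : sg_group -> sg_dim.-tuple K;
  sg_inj : injective sg_coord;
  sg_set : semialgebraic_set (fun t => exists x, t = sg_coord x);
  sg_mul : semialgebraic_set
    (fun t : (sg_dim + (sg_dim + sg_dim)).-tuple K => exists x y,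
       t = [tuple of sg_coord x ++ (sg_coord y ++ sg_coord (x * y)%g)])
}.

Definition sg_atlas (H : semialgebraic_group) : atlas K (sg_group H) :=
  @Atlas K (sg_group H) unit (fun=> sg_dim H) (fun _ _ => True)
    (fun _ => @sg_coord H).

Definition semialgebraic (V : lmodType K) (form : V -> V -> K) (G : igroup V)
    : Prop :=
  exists (H : semialgebraic_group) (f : point V (gm G) (gn G) -> sg_group H),
    definable_iso form (sg_atlas H) f.

End Semialgebraic.


Definition has_char (K : fieldType) (p : nat) : Prop :=
  if p == 0%N then [pchar K] =i pred0 else p \in [pchar K].

Definition infinite_dimensional (K : fieldType) (V : lmodType K) : Prop :=
  forall n : nat, exists e : 'I_n -> V,
    forall c : 'I_n -> K, \sum_(i < n) c i *: e i = 0 -> forall i, c i = 0.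

Definition nondegenerate_form (K : fieldType) (V : lmodType K)
    (form : V -> V -> K) : Prop :=
  forall v, (forall w, form v w = 0) -> v = 0.

Definition symmetric_form (K : fieldType) (V : lmodType K)
    (form : V -> V -> K) : Prop :=
  forall v w, form v w = form w v.

Definition alternating_form (K : fieldType) (V : lmodType K)
    (form : V -> V -> K) : Prop :=
  forall v, form v v = 0.

Definition posdef_form (K : rcfType) (V : lmodType K)
    (form : V -> V -> K) : Prop :=
  forall v, v != 0 -> 0 < form v v.

(* Either of the two theories T_oo. *)
Definition model_Tinf (p : nat) (K : closedFieldType) (V : lmodType K)
    (form : {biscalar V}) : Prop :=
  [/\ has_char K p, infinite_dimensional V, nondegenerate_form form
    & symmetric_form form \/ alternating_form form].

(* Either of the two theories T^RCF_oo. *)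
Definition model_TRCFinf (K : rcfType) (V : lmodType K) (form : {biscalar V})
    : Prop :=
  infinite_dimensional V /\
  (symmetric_form form /\ posdef_form form \/
   nondegenerate_form form /\ alternating_form form).


(* (v, a) . (v', a') = (v + a v', a a'), on V x K^* *)
Definition semidirect_group (K : fieldType) (V : lmodType K) : igroup V :=
  let vec (x : point V 1 1) := tnth x.1 ord0 in
  let sca (x : point V 1 1) := tnth x.2 ord0 in
  @IGroup K V 1 1 (fun x => sca x != 0) eq
    (fun x y => ([tuple vec x + sca x *: vec y], [tuple sca x * sca y]))
    ([tuple 0], [tuple 1])
    (fun x => ([tuple - ((sca x)^-1 *: vec x)], [tuple (sca x)^-1])).

Definition heisenberg_group (K : fieldType) (V : lmodType K)
    (form : V -> V -> K) : igroup V :=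
  let fst (x : point V 2 1) := tnth x.1 ord0 in
  let snd (x : point V 2 1) := tnth x.1 ord_max in
  let sca (x : point V 2 1) := tnth x.2 ord0 in
  @IGroup K V 2 1 (fun=> True) eq
    (fun x y => ([tuple fst x + fst y; snd x + snd y],
                 [tuple sca x + sca y + form (fst x) (snd y)]))
    ([tuple 0; 0], [tuple 0])
    (fun x => ([tuple - fst x; - snd x],
               [tuple - sca x + form (fst x) (snd x)])).

(* Main.v *)
(* A linear isometry of V acts trivially on K, so it is an automorphism of the
   model (V, K) over K.  A definable isomorphism with a [semi]algebraic group
   involves finitely many vector parameters us, and the isometries fixing us
   therefore act trivially on any [semi]algebraic group.  On the other hand,
   the orthogonal of us is not totally isotropic, so reflections or
   transvections along it give isometries s, s' fixing us and vectors v, v'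
   with [s v - v, s' v' - v'] <> 0.
   (i) A normal subgroup N of V x| K^* with abelian quotient contains V, hence
   is not [semi]algebraic since s moves v.
   (ii) If the quotient of the Heisenberg group by N is [semi]algebraic, then N
   contains (v - s v, 0, 0) and (0, v' - s' v', 0), which do not commute. *)

Require Import Defs.
From HB Require Import structures.
From mathcomp Require Import all_boot all_order all_algebra.
From mathcomp Require Import mpoly.
From mathcomp Require Import ring.
From Stdlib Require Import Classical.

Set Implicit Arguments.
Unset Strict Implicit.
Unset Printing Implicit Defensive.

Import Order.TTheory GRing.Theory Num.Theory.
Local Open Scope ring_scope.

(** * Orthogonality, transvections and isometries of a bilinear form *)

Section Isometries.
Variables (K : fieldType) (V : lmodType K) (form : {biscalar V}).

Definition isometry (s : V -> V) : Prop :=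
  bijective s /\ forall x y, form (s x) (s y) = form x y.

Definition orthogonal_to (us : seq V) (w : V) : Prop :=
  forall u, u \in us -> form w u = 0.

Lemma orthogonal_to_cons u us w :
  orthogonal_to (u :: us) w <-> form w u = 0 /\ orthogonal_to us w.
Proof.
split=> [wus|[wu wus] u']; last by rewrite inE => /predU1P[->|/wus].
by split=> [|u' u'us]; apply: wus; rewrite inE ?eqxx // u'us orbT.
Qed.

Lemma orthogonal_to_cat us ts w :
  orthogonal_to (us ++ ts) w -> orthogonal_to us w /\ orthogonal_to ts w.
Proof. by move=> wo; split=> u uin; apply: wo; rewrite mem_cat uin ?orbT. Qed.

(** Pairing one more independent vector than [size us] with [us] gives a matrix with more rows than
    columns. A nonzero row in its left kernel lists the coefficients of [w]. *)
Lemma exists_nonzero_orthogonal (us : seq V) :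
  infinite_dimensional V -> exists2 w, w != 0 & orthogonal_to us w.
Proof.
case/(_ (size us).+1) => e e_free.
pose A := \matrix_(i < (size us).+1, j < size us) form (e i) us`_j.
have /rowV0Pn[r rA r0] : kermx A != 0.
  by rewrite kermx_eq0 /row_free ltn_eqF // ltnS rank_leq_col.
exists (\sum_i r 0 i *: e i).
  apply: contra_neq r0 => /e_free r0; apply/rowP => i; by rewrite r0 mxE.
move=> u u_us; have lt_u : (index u us < size us)%N by rewrite index_mem.
move: rA => /sub_kermxP/rowP/(_ (Ordinal lt_u)); rewrite !mxE => <-.
rewrite -[u in LHS](nth_index 0 u_us) linear_sumlz; apply: eq_bigr => i _.
by rewrite linearZl_LR mxE.
Qed.

(* ts spans a complement of the orthogonal of us. *)
Lemma orthogonal_complement (us : seq V) :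
  exists ts : seq V, forall x, exists2 x0, orthogonal_to us x0 &
    forall w, orthogonal_to ts w -> form w x = form w x0.
Proof.
elim: us => [|u us [ts IH]]; first by exists [::] => x; exists x.
(* Subtracting a multiple of [t] makes [x0] orthogonal to [u] as well. Vectors orthogonal to [t] do
   not see this correction, so [t] joins [ts]. *)
have [[t tus tu]|no_t] := classic (exists2 t, orthogonal_to us t & form t u != 0).
  exists (t :: ts) => x; have [x0 x0us x0E] := IH x.
  exists (x0 - (form x0 u / form t u) *: t).
    apply/orthogonal_to_cons; split=> [|u' u'us].
      by rewrite linearBl linearZl_LR /= divfK ?subrr.
    by rewrite linearBl linearZl_LR /= (tus _ u'us) (x0us _ u'us) mulr0 subrr.
  move=> w /orthogonal_to_cons[wt /x0E ->].
  by rewrite linearBr linearZr_LR /= wt mulr0 subr0.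
(* Otherwise the orthogonal of [us] is already orthogonal to [u], and [x0] needs no correction. *)
exists ts => x; have [x0 x0us x0E] := IH x; exists x0 => //.
apply/orthogonal_to_cons; split=> //; apply/eqP/negPn/negP => x0u.
by apply: no_t; exists x0.
Qed.

(** If the orthogonal of [us] were totally isotropic, a nonzero [w] orthogonal to [us ++ ts] would
    satisfy [form w x = form w x0 = 0] for every [x], against nondegeneracy. *)
Lemma orthogonal_not_isotropic (us : seq V) :
    infinite_dimensional V -> nondegenerate_form form ->
  exists w w', [/\ orthogonal_to us w, orthogonal_to us w' & form w w' != 0].
Proof.
move=> infV nondeg; apply: NNPP => isotropic.
have [ts tsP] := orthogonal_complement us.
have [w w_neq0 /orthogonal_to_cat[wus wts]] :=
  exists_nonzero_orthogonal (us ++ ts) infV.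
case/eqP: w_neq0; apply: nondeg => x; have [x0 x0us ->] := tsP x => //.
by apply/eqP; apply: contra_notT isotropic => wx0; exists w, x0.
Qed.

Section Transvection.
Variables (c : K) (w : V).

(* The reflection in w is the case c = - 2 / form w w. *)
Definition transvection (x : V) : V := x + (c * form x w) *: w.

Fact transvection_is_linear : linear transvection.
Proof.
move=> a x y; rewrite /transvection linearPl /= mulrDr scalerDl scalerDr.
by rewrite addrACA mulrCA scalerA.
Qed.

HB.instance Definition _ :=
  GRing.isLinear.Build K V V *:%R transvection transvection_is_linear.

End Transvection.

Lemma transvection_sub c w x : transvection c w x - x = (c * form x w) *: w.
Proof. by rewrite /transvection addrAC subrr add0r. Qed.

Lemma transvection_id c w x : form x w = 0 -> transvection c w x = x.
Proof. by rewrite /transvection => ->; rewrite mulr0 scale0r addr0. Qed.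

(** The composite is the transvection along [w] with coefficient [c + d + c * d * form w w]. *)
Lemma transvection_comp c d w :
  c + d + c * d * form w w = 0 -> cancel (transvection c w) (transvection d w).
Proof.
move=> cd0 x; rewrite /transvection linearDl linearZl_LR /=.
rewrite -addrA -scalerDl (_ : _ + _ = form x w * (c + d + c * d * form w w)).
  by rewrite cd0 mulr0 scale0r addr0.
by ring.
Qed.

Lemma transvection_form c w x y :
  form (transvection c w x) (transvection c w y) =
    form x y + c * (form x w * form w y + form y w * form x w +
                    c * form x w * form y w * form w w).
Proof.
rewrite /transvection !(linearDl, linearDr, linearZl_LR, linearZr_LR) /=.
by ring.
Qed.

Lemma isometry_symmetric_transvection w :
    Defs.symmetric_form form -> form w w != 0 ->
  isometry (transvection (- (2%:R / form w w)) w).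
Proof.
move=> symf ww; split.
  by exists (transvection (- (2%:R / form w w)) w);
    apply: transvection_comp; field.
by move=> x y; rewrite transvection_form (symf w y); field.
Qed.

Lemma alternating_skew :
  Defs.alternating_form form -> forall x y, form x y = - form y x.
Proof.
move=> altf x y; apply/eqP; rewrite -addr_eq0; apply/eqP.
by have := altf (x + y); rewrite linearDl !linearDr /= !altf add0r addr0.
Qed.

Lemma isometry_alternating_transvection c w :
  Defs.alternating_form form -> isometry (transvection c w).
Proof.
move=> altf; have skew := alternating_skew altf.
split; last by move=> x y; rewrite transvection_form altf (skew w y); ring.
by exists (transvection (- c) w); apply: transvection_comp; rewrite altf; ring.
Qed.

Definition isometry_over (us : seq V) (s : {linear V -> V}) : Prop :=
  isometry s /\ {in us, s =1 id}.

Lemma exists_isometries_over (us : seq V) :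
    2%:R != 0 :> K -> infinite_dimensional V -> nondegenerate_form form ->
    Defs.symmetric_form form \/ Defs.alternating_form form ->
  exists (s s' : {linear V -> V}) (v v' : V),
    [/\ isometry_over us s, isometry_over us s'
      & form (s v - v) (s' v' - v') != 0].
Proof.
move=> two_neq0 infV nondeg [symf|altf];
  have [w [w' [wus w'us ww']]] := orthogonal_not_isotropic us infV nondeg.
  (* If [w] and [w'] are both isotropic, then [w + w'] pairs with itself to [2 * form w w'], nonzero
     outside characteristic 2. *)
  have [z zus zz] : exists2 z, orthogonal_to us z & form z z != 0.
    have [ww|] := eqVneq (form w w) 0; last by exists w.
    have [w'w'|] := eqVneq (form w' w') 0; last by exists w'.
    exists (w + w'); first by move=> u uus; rewrite linearDl wus // w'us ?addr0.
    rewrite linearDl !linearDr /= ww w'w' add0r addr0 (symf w' w) -mulr2n.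
    by rewrite -mulr_natl mulf_neq0.
  pose s := transvection (- (2%:R / form z z)) z.
  have sP : isometry_over us s.
    split; first exact: isometry_symmetric_transvection.
    by move=> u uus; apply: transvection_id; rewrite symf zus.
  exists s, s, z, z; split=> //.
  rewrite transvection_sub mulNr divfK // linearZl_LR linearZr_LR /=.
  by rewrite !mulf_neq0 ?oppr_eq0.
have skew := alternating_skew altf.
have over z : orthogonal_to us z -> isometry_over us (transvection 1 z).
  move=> zus; split; first exact: isometry_alternating_transvection.
  by move=> u uus; apply: transvection_id; rewrite skew zus ?oppr0.
(* The vectors are swapped because [w] is fixed by its own transvection; [w'] is displaced by a
   nonzero multiple of [w], and conversely. *)
exists (transvection 1 w), (transvection 1 w'), w', w.
split; [exact: over|exact: over|rewrite !transvection_sub !mul1r].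
rewrite linearZl_LR linearZr_LR /= !mulf_neq0 //.
by rewrite skew oppr_eq0.
Qed.

End Isometries.

(* Isometries as automorphisms of the two-sorted structure *)
Scheme vterm_mutind := Induction for vterm Sort Prop
with kterm_mutind := Induction for kterm Sort Prop.
Combined Scheme term_mutind from vterm_mutind, kterm_mutind.

Section Invariance.
Variables (K : fieldType) (V : lmodType K) (form : {biscalar V}).

Definition map_env (s : V -> V) (e : env V) : env V := (map s e.1, e.2).

Definition map_point m n (s : V -> V) (x : point V m n) : point V m n :=
  (map_tuple s x.1, x.2).

Lemma val_map_env (s : {linear V -> V}) (e : env V) : isometry form s ->
  (forall t, vval form (map_env s e) t = s (vval form e t)) /\
  (forall t, kval form (map_env s e) t = kval form e t).
Proof.
case=> _ sform; apply: term_mutind => //=.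
(* An index beyond the environment denotes 0, which the linear map [s] fixes. *)
- by case: e => e _ /=; elim: e => [|v e IH] [|i] //=; rewrite linear0.
- by rewrite linear0.
- by move=> t -> t' ->; rewrite linearD.
- by move=> t -> t' ->; rewrite linearZ.
- by move=> t -> t' ->.
- by move=> t -> t' ->.
- by move=> t -> t' ->.
Qed.

Lemma holds_map_env (s : {linear V -> V}) f (e : env V) : isometry form s ->
  holds form (map_env s e) f <-> holds form e f.
Proof.
move=> sP; have [[s' sK s'K] _] := sP.
elim: f e => [t t'|t t'|f IH|f IHf g IHg|f IH|f IH] e /=.
- have [vE _] := val_map_env e sP; rewrite !vE.
  by split=> [/(can_inj sK)|->].
- by have [_ kE] := val_map_env e sP; rewrite !kE.
- by rewrite IH.
- by rewrite IHf IHg.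
(* Surjectivity of [s] matters here: a witness for the moved environment is pulled back along
   [s']. *)
- split=> -[v fv].
    by exists (s' v); apply/IH; rewrite /map_env /= s'K.
  by exists (s v); move/IH: fv.
- by split=> -[a fa]; exists a; [apply/IH|move/IH: fa].
Qed.

(** The list [us] consists of the vector parameters of a defining formula; scalar parameters are
    never moved. *)
Lemma definable2_invariant m1 n1 m2 n2
    (A : point V m1 n1 -> point V m2 n2 -> Prop) : definable2 form A ->
  exists us, forall s, isometry_over form us s ->
    forall x y, A (map_point s x) (map_point s y) <-> A x y.
Proof.
case=> f [c AP]; exists c.1 => s [sP sid] x y.
rewrite !AP -[X in _ <-> X](holds_map_env f _ sP).
by rewrite /map_env /env_cat /= !map_cat (map_id_in sid).
Qed.

(* Isometries fix K pointwise, so they are the automorphisms of the model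
   over K; this is the only property of [semi]algebraic groups that is used. *)
Definition finitely_supported (G : igroup V) : Prop :=
  exists us, forall s, isometry_over form us s ->
    forall x, gcar G x -> geqv G (map_point s x) x.

(** Chart coordinates are scalars, so an isometry preserving the graph of [f] in a chart sends [x]
    to a point with the same coordinates, hence with the same image under [f]. *)
Lemma definable_iso_finitely_supported (G : igroup V) (H : groupType)
    (A : atlas K H) (f : point V (gm G) (gn G) -> H) :
    (forall h, exists i : aix A, adom i h) ->
    (forall (i : aix A) x y, adom i x -> adom i y ->
       achart i x = achart i y -> x = y) ->
    definable_iso form A f ->
  finitely_supported G.
Proof.
move=> cover chart_inj [_ f_inj _ f_def].
(* The atlas is finite, so the vector parameters of all chart graphs can be concatenated. *)
have [us usP] : exists us, forall i, i \in enum (aix A) ->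
    forall s, isometry_over form us s -> forall x, gcar G x -> adom i (f x) ->
    geqv G (map_point s x) x.
  elim: (enum _) => [|i r [us IH]]; first by exists [::].
  have [us' us'P] := definable2_invariant (f_def i).
  exists (us' ++ us) => j; rewrite inE => ij s [sP sid] x Gx fxj.
  have s_us' : isometry_over form us' s.
    by split=> // u uus; apply: sid; rewrite mem_cat uus.
  have s_us : isometry_over form us s.
    by split=> // u uus; apply: sid; rewrite mem_cat uus orbT.
  case/predU1P: ij => [ij|jr]; last exact: IH jr s s_us x Gx fxj.
  subst j; have [] := us'P s s_us' x ([tuple], achart i (f x)).
  move=> _ [//|Gsx fsxi /= eq_chart]; apply/(f_inj _ _ Gsx Gx).
  exact: chart_inj fsxi fxj _.
exists us => s sP x Gx; have [i fxi] := cover (f x).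
by apply: (usP i) => //; rewrite mem_enum.
Qed.

Lemma is_by_impl (P P' Q Q' : igroup V -> Prop) (G : igroup V) :
    (forall H, P H -> P' H) -> (forall H, Q H -> Q' H) ->
  is_by form P Q G -> is_by form P' Q' G.
Proof. by move=> PP' QQ' [N [? /PP' ? /QQ' ?]]; exists N. Qed.

(** * Definability of the two groups *)

Lemma point11P (x : point V 1 1) : exists v a, x = ([tuple v], [tuple a]).
Proof.
case: x => s t; exists (tnth s ord0), (tnth t ord0).
by congr pair; apply: eq_from_tnth => i; rewrite ord1.
Qed.

Lemma point21P (x : point V 2 1) :
  exists v w a, x = ([tuple v; w], [tuple a]).
Proof.
case: x => s t; exists (tnth s ord0), (tnth s ord_max), (tnth t ord0).
congr pair; apply: eq_from_tnth => i; last by rewrite ord1.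
by case: i => [[|[|//]] ?]; congr (tnth _ _); apply: val_inj.
Qed.

Lemma definable_semidirect : definable_group form (semidirect_group V).
Proof.
split=> //; split=> //.
- split.
  + by exists (FNot (FEqK (KVar 0) KZero)), ([::], [::]) => x;
      have [v [a ->]] := point11P x; split=> [/= /eqP|/= /eqP].
  + exists (FAnd (FNot (FEqK (KVar 0) KZero))
      (FAnd (FEqV (VVar 0) (VVar 1)) (FEqK (KVar 0) (KVar 1)))), ([::], [::]).
    move=> x y; have [v [a ->]] := point11P x; have [w [b ->]] := point11P y.
    by split=> [/= [/eqP ? _ [<- <-]] //|/= [/eqP ? [<- <-]]].
  + exists (FAnd (FAnd (FNot (FEqK (KVar 0) KZero))
      (FNot (FEqK (KVar 1) KZero)))
      (FAnd (FEqV (VAdd (VVar 0) (VScale (KVar 0) (VVar 1))) (VVar 2))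
        (FEqK (KMul (KVar 0) (KVar 1)) (KVar 2)))), ([::], [::]).
    move=> x y z; have [v [a ->]] := point11P x.
    have [w [b ->]] := point11P y; have [u [c ->]] := point11P z.
    split=> [/= [/eqP ? /eqP ? _ [-> ->]] //|/= [[/eqP a0 /eqP b0] [<- <-]]].
    by split=> //; rewrite mulf_neq0.
- by split=> // x y z _ _ _ -> ->.
- split=> [|x y|x] /=; rewrite ?oner_eq0 ?invr_eq0 //.
  exact: mulf_neq0.
- by move=> x x' y y' _ _ _ _ -> ->.
- split=> [x y z|x|x]; have [v [a ->]] := point11P x.
  + have [w [b ->]] := point11P y; have [u [c ->]] := point11P z => _ _ _ /=.
    congr ([tuple _], [tuple _]); last exact: mulrA.
    by rewrite scalerDr scalerA addrA.
  + by move=> _ /=; congr ([tuple _], [tuple _]); rewrite ?scale1r ?add0r ?mul1r.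
  + by move=> a0 /=; congr ([tuple _], [tuple _]); rewrite ?addNr ?mulVf.
Qed.

Lemma definable_heisenberg : definable_group form (heisenberg_group form).
Proof.
split=> //; split=> //.
- split.
  + by exists (FEqK KZero KZero), ([::], [::]).
  + exists (FAnd (FAnd (FEqV (VVar 0) (VVar 2)) (FEqV (VVar 1) (VVar 3)))
      (FEqK (KVar 0) (KVar 1))), ([::], [::]).
    move=> x y; have [v [w [a ->]]] := point21P x.
    have [v' [w' [a' ->]]] := point21P y.
    by split=> [/= [_ _ [-> -> ->]] //|/= [[-> ->] ->]].
  (* The vectors of [x], [y], [z] have indices 0 and 1, 2 and 3, 4 and 5; their scalars have indices
     0, 1, 2. *)
  + exists (FAnd (FAnd (FEqV (VAdd (VVar 0) (VVar 2)) (VVar 4))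
      (FEqV (VAdd (VVar 1) (VVar 3)) (VVar 5)))
      (FEqK (KAdd (KAdd (KVar 0) (KVar 1)) (KForm (VVar 0) (VVar 3)))
        (KVar 2))), ([::], [::]).
    move=> x y z; have [v [w [a ->]]] := point21P x.
    have [v' [w' [a' ->]]] := point21P y; have [u [u' [c ->]]] := point21P z.
    by split=> [/= [_ _ _ [-> -> ->]] //|/= [[<- <-] <-]].
- by split=> // x y z _ _ _ -> ->.
- by move=> x x' y y' _ _ _ _ -> ->.
- split=> [x y z|x|x] /=; have [v [w [a ->]]] := point21P x.
  + have [v' [w' [a' ->]]] := point21P y; have [u [u' [c ->]]] := point21P z.
    move=> _ _ _ /=; congr ([tuple _; _], [tuple _]); rewrite ?addrA //.
    by rewrite linearDl linearDr /tnth /=; ring.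
  + move=> _ /=; congr ([tuple _; _], [tuple _]); rewrite ?add0r //.
    by rewrite /tnth /= linear0l addr0.
  + move=> _ /=; congr ([tuple _; _], [tuple _]); rewrite ?addNr //.
    by rewrite linearNl /tnth /=; ring.
Qed.

(** * Obstructions to the two forms of extension *)

Hypothesis two_neq0 : 2%:R != 0 :> K.
Hypothesis infV : infinite_dimensional V.
Hypothesis nondeg : nondegenerate_form form.
Hypothesis symm_or_alt : Defs.symmetric_form form \/ Defs.alternating_form form.

Lemma semidirect_not_by_abelian :
  ~ is_by form finitely_supported (@abelian_igroup K V) (semidirect_group V).
Proof.
case=> N [_ [us usP] abGN].
(* The commutator of (v/2, 1) and (0, -1). *)
have Nv v : N ([tuple v], [tuple 1]).
  pose x : point V 1 1 := ([tuple 2%:R^-1 *: v], [tuple 1]).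
  pose y : point V 1 1 := ([tuple 0], [tuple -1]).
  have := abGN x y; rewrite /= oppr_eq0 oner_eq0 => /(_ isT isT).
  rewrite /= /tnth /= !scaler0 !addr0 add0r mul1r mulr1 invrN1 scaleN1r opprK.
  rewrite scalerN scaleN1r opprK.
  by rewrite -scalerDl (_ : _ + _ = 1) ?scale1r ?mulrNN ?mulr1 //; field.
have [s [s' [v [v' [sP _]]]]] :=
  exists_isometries_over us two_neq0 infV nondeg symm_or_alt.
(* Finite support forces [s v = v], although [s v - v] has a nonzero pairing. *)
have /= [->] := usP s sP _ (Nv v).
by rewrite subrr linear0l eqxx.
Qed.

Lemma heisenberg_not_abelian_by :
  ~ is_by form (@abelian_igroup K V) finitely_supported (heisenberg_group form).
Proof.
case=> N [_ abN [us usP]].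
have [s [s' [v [v' [sP s'P]]]]] :=
  exists_isometries_over us two_neq0 infV nondeg symm_or_alt.
(* This element is the inverse of the image of [(v, 0, 0)] under [s], times [(v, 0, 0)]; it lies in
   [N] because the quotient identifies the two. *)
have Nv : N ([tuple - s v + v; 0], [tuple 0]).
  have /= := usP s sP ([tuple v; 0], [tuple 0]) I.
  by rewrite /tnth /= !(linear0, addr0, oppr0).
have Nv' : N ([tuple 0; - s' v' + v'], [tuple 0]).
  have /= := usP s' s'P ([tuple 0; v'], [tuple 0]) I.
  by rewrite /tnth /= !(linear0, linear0l, add0r, addr0, oppr0).
(* The two products differ only in the scalar coordinate, which contains the pairing in one order
   and 0 in the other. *)
have /= [_ _] := abN _ _ Nv Nv'.
rewrite /tnth /= linear0l !addr0 add0r ![- _ + _]addrC -(opprB (s v)).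
by rewrite -(opprB (s' v')) linearNl linearNr opprK => -> /eqP.
Qed.

(** Abstracting over [P] treats the algebraic and semialgebraic cases at once. *)
Lemma not_extension_of_finitely_supported (P : igroup V -> Prop) :
    (forall G, P G -> finitely_supported G) ->
  [/\ ~ (forall G : igroup V, definable_group form G ->
           is_by form P (@abelian_igroup K V) G),
      ~ (forall G : igroup V, definable_group form G ->
           is_by form (@abelian_igroup K V) P G),
      definable_group form (semidirect_group V) /\
      ~ is_by form P (@abelian_igroup K V) (semidirect_group V)
    & definable_group form (heisenberg_group form) /\
      ~ is_by form (@abelian_igroup K V) P (heisenberg_group form)].
Proof.
move=> PS; pose def_sd := definable_semidirect.
pose def_heis := definable_heisenberg.
have no_sd : ~ is_by form P (@abelian_igroup K V) (semidirect_group V).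
  by move=> /(is_by_impl PS (fun=> id)); apply: semidirect_not_by_abelian.
have no_heis : ~ is_by form (@abelian_igroup K V) P (heisenberg_group form).
  by move=> /(is_by_impl (fun=> id) PS); apply: heisenberg_not_abelian_by.
by split; [move/(_ _ def_sd)|move/(_ _ def_heis)| |].
Qed.

End Invariance.

(** * Application to algebraic and semialgebraic groups *)

Lemma algebraic_finitely_supported (K : closedFieldType) (V : lmodType K)
    (form : {biscalar V}) (G : igroup V) :
  algebraic form G -> finitely_supported form G.
Proof.
case=> H [f fP]; have [cover chart_inj _ _ _] := ag_variety H.
exact: definable_iso_finitely_supported cover chart_inj fP.
Qed.

Lemma semialgebraic_finitely_supported (K : rcfType) (V : lmodType K)
    (form : {biscalar V}) (G : igroup V) :
  semialgebraic form G -> finitely_supported form G.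
Proof.
case=> H [f fP]; apply: definable_iso_finitely_supported fP.
  by move=> h; exists tt.
by move=> i x y _ _ /sg_inj.
Qed.

Lemma has_char_two_neq0 (K : fieldType) (p : nat) :
  p <> 2%N -> has_char K p -> 2%:R != 0 :> K.
Proof.
move=> p_neq2 charK; apply/negP => two0.
have char2 : 2%N \in [pchar K] by rewrite inE.
(* A field has at most one positive characteristic, so 2 would have to equal [p]. *)
move: charK; rewrite /has_char; case: eqP => [_ charK|_ /pcharf_eq charK].
  by rewrite charK in char2.
by move: char2; rewrite charK => /eqP/esym.
Qed.

Lemma posdef_nondegenerate (K : rcfType) (V : lmodType K)
    (form : V -> V -> K) : posdef_form form -> nondegenerate_form form.
Proof.
move=> pos v v0; apply/eqP; apply: contraTT isT => /pos.
by rewrite v0 ltxx.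
Qed.

Theorem mainTheorem13 :
  (forall (p : nat) (K : closedFieldType) (V : lmodType K)
          (form : {biscalar V}),
     p = 0%N \/ (prime p /\ p <> 2%N) ->
     model_Tinf p form -> aleph0_saturated form ->
     [/\ ~ (forall G : igroup V, definable_group form G ->
              is_by form (algebraic form) (@abelian_igroup K V) G),
         ~ (forall G : igroup V, definable_group form G ->
              is_by form (@abelian_igroup K V) (algebraic form) G),
         definable_group form (semidirect_group V) /\
         ~ is_by form (algebraic form) (@abelian_igroup K V)
             (semidirect_group V)
       & definable_group form (heisenberg_group form) /\
         ~ is_by form (@abelian_igroup K V) (algebraic form)
             (heisenberg_group form)])
  /\
  (forall (K : rcfType) (V : lmodType K) (form : {biscalar V}),
     model_TRCFinf form -> aleph0_saturated form ->
     [/\ ~ (forall G : igroup V, definable_group form G ->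
              is_by form (semialgebraic form) (@abelian_igroup K V) G),
         ~ (forall G : igroup V, definable_group form G ->
              is_by form (@abelian_igroup K V) (semialgebraic form) G),
         definable_group form (semidirect_group V) /\
         ~ is_by form (semialgebraic form) (@abelian_igroup K V)
             (semidirect_group V)
       & definable_group form (heisenberg_group form) /\
         ~ is_by form (@abelian_igroup K V) (semialgebraic form)
             (heisenberg_group form)]).
Proof.
split=> [p K V form p_char [charK infV nondeg symm_or_alt] _|K V form];
  last case=> infV symm_or_alt _.
  apply: not_extension_of_finitely_supported => //; last first.
    exact: algebraic_finitely_supported.
  by apply: has_char_two_neq0 charK; case: p_char => [->|[]].
apply: not_extension_of_finitely_supported => //.
- by rewrite pnatr_eq0.
- by case: symm_or_alt => -[]// _ /posdef_nondegenerate.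
- by case: symm_or_alt => -[]; [left|right].
- exact: semialgebraic_finitely_supported.
Qed.
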